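(* Let $\Gamma$ be a (finite, simple, undirected) graph on $n\geq 2$ vertices with $e$ edges and let $A$ be its adjacency matrix. Then \[\det(J-2A-I)\equiv(-1)^n(1-n)+4en \pmod 8.\]
   Context: $J$ denotes the $n\times n$ matrix with all entries $1$ and $I$ the $n\times n$ identity matrix. *)

(* Defs.v *)
From HB Require Import structures.
From mathcomp Require Import all_boot all_order all_algebra.
Set Implicit Arguments.
Unset Strict Implicit.
Unset Printing Implicit Defensive.
Import GRing.Theory.
Local Open Scope ring_scope.

Record simple_graph (T : finType) := SimpleGraph {
  adj : rel T;
  adj_sym : symmetric adj;
  adj_irrefl : irreflexive adj
}.

(* Edges are unordered pairs, so each edge is counted once. *)
Definition edge_set (T : finType) (G : simple_graph T) : {set {set T}} :=
  [set [set x; y] | x in T, y in adj G x].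

(* The vertices are numbered by their canonical enumeration [enum_val]. *)
Definition adjacency_matrix (T : finType) (G : simple_graph T) :
    'M[int]_#|T| :=
  \matrix_(i, j) (adj G (enum_val i) (enum_val j))%:R.

Definition all_ones_matrix (n : nat) : 'M[int]_n := const_mx 1.

(* Main.v *)
Require Import Defs.
From HB Require Import structures.
From mathcomp Require Import all_boot all_order all_algebra.
From mathcomp Require Import ring.
Set Implicit Arguments.
Unset Strict Implicit.
Unset Printing Implicit Defensive.
Import GRing.Theory.
Local Open Scope ring_scope.

(** Put [N = I + 2A] and let [u] be the all-ones row, so that the matrix of the
    theorem is [-(N - u^T u)].  By the matrix determinant lemma
    ([det_sub_rank1]) its determinant is
    [(-1)^n (det N - u adj(N) u^T)], and both terms are easy 2-adically.

    - The inverse of [N] is the geometric series [I - 2A + 4A^2] modulo 8,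
      whence [adj N = det N (I - 2A + 4A^2)] modulo 8 ([adj_1Dmul2]).  The three
      resulting sums are [u u^T = n], [u A u^T = 2e] by the handshake lemma
      ([sum_adjacency]), and [u A^2 u^T], the sum of the squares of the degrees,
      which is even because it has the parity of the sum of the degrees
      ([even_sum_adjacency_sqr]).  Hence [u adj(N) u^T = det N (n - 4e)]
      modulo 8.
    - As [A] has zero diagonal, [det N = 1 - 2 tr(A^2) = 1 - 4e] modulo 8
      ([det_1Dmul2], [trace_adjacency_sqr]): in the expansion of the determinant
      over permutations, one that moves [k] points contributes a multiple of
      [2^k], so only the identity and the transpositions matter.

    The determinant is therefore congruent to
    [(-1)^n (1 - 4e) (1 - n + 4e) = (-1)^n (1 - n + 4en)], and the sign is
    immaterial on a multiple of 4. *)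

(** * Bordered determinants and rank-one updates *)

(** Eliminate the column [c] by multiplying on the right with the
    block-triangular matrix of blocks [det M], [0], [- adj(M) c], [1].  This
    multiplies the determinant by [det M], which has to be cancelled. *)
Lemma det_bordered (R : idomainType) n (a : R) (r : 'rV[R]_n) (c : 'cV[R]_n)
    (M : 'M[R]_n) :
  \det M != 0 ->
  \det (block_mx a%:M r c M) = a * \det M - (r *m \adj M *m c) 0 0.
Proof.
move=> dM0; apply: (mulIf dM0).
pose P := block_mx (\det M)%:M 0 (- (\adj M *m c)) 1%:M.
have detP : \det P = \det M.
  by rewrite det_lblock det_scalar1 det1 mulr1.
have -> : \det (block_mx a%:M r c M) * \det M = \det (block_mx a%:M r c M *m P).
  by rewrite det_mulmx detP.
rewrite mulmx_block !mulmxN !mulmxA mul_mx_adj !mul_scalar_mx !mul_mx_scalar.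
rewrite subrr !mulmx0 !scale1r !add0r scale_scalar_mx det_ublock; congr (_ * _).
by rewrite [_ - _]mx11_scalar det_scalar1 !mxE eqxx mulr1n.
Qed.

(** Both sides compute the determinant of [M] bordered by [1], [r] and [c]:
    the left-hand side is what remains of it after clearing the column [c] by
    means of the corner [1]. *)
Lemma det_sub_rank1 (R : idomainType) n (r : 'rV[R]_n) (c : 'cV[R]_n)
    (M : 'M[R]_n) :
  \det M != 0 ->
  \det (M - c *m r) = \det M - (r *m \adj M *m c) 0 0.
Proof.
move=> dM0; rewrite -[\det M in RHS]mul1r -det_bordered //.
have -> : block_mx 1%:M r c M
    = block_mx 1%:M 0 c 1%:M *m block_mx 1%:M r 0 (M - c *m r).
  rewrite mulmx_block !mul1mx !mul0mx mulmx1 !addr0.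
  by rewrite [c *m r + _]addrC subrK.
by rewrite det_mulmx det_lblock det_ublock !det1 !mul1r.
Qed.

(** * The matrix 1 + 2X modulo 8 *)

(** Multiply [(1 - 2X + 4X^2) (1 + 2X) = 1 + 8X^3] on the right by
    [adj (1 + 2X)]. *)
Lemma adj_1Dmul2 (R : comNzRingType) n (X : 'M[R]_n) (N := 1%:M + 2 *: X) :
  \adj N = \det N *: (1%:M - 2 *: X + 4 *: (X *m X))
           - 8 *: (X *m X *m X *m \adj N).
Proof.
set Q := 1%:M - 2 *: X + 4 *: (X *m X).
have QN : Q *m N = 1%:M + 8 *: (X *m X *m X).
  rewrite /Q /N mulmxDr mulmx1 -scalemxAr !mulmxDl !mulNmx mul1mx -!scalemxAl.
  rewrite !scalerDr !scalerN !scalerA; apply/matrixP=> i j; rewrite !mxE; ring.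
rewrite -[in LHS](mul1mx (\adj N)) -[1%:M](addrK (8 *: (X *m X *m X))) -QN.
by rewrite mulmxBl -mulmxA mul_mx_adj mul_mx_scalar -scalemxAl.
Qed.

(** With the quotient as an explicit witness, a congruence can be proved by
    [ring]. *)
Lemma eqz_modP (x y d : int) :
  (x = y %[mod d])%Z <-> exists k, x = y + k * d.
Proof.
split=> [/eqP | [k ->]]; last by rewrite addrC modzMDl.
by rewrite eqz_mod_dvd => /dvdzP[k Dxy]; exists k; rewrite -Dxy addrC subrK.
Qed.

Lemma odd_neq0 (k : int) : 1 + 2 * k != 0.
Proof.
apply/eqP=> k0; suff: (2 %| (1 : int))%Z by [].
by apply/dvdzP; exists (- k); rewrite -[RHS]add0r -k0; ring.
Qed.

Lemma form_adj_1Dmul2 n (X : 'M[int]_n) (r : 'rV_n) (c : 'cV_n)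
    (N := 1%:M + 2 *: X) :
  (((r *m \adj N *m c) 0 0)%R =
    (\det N * ((r *m c) 0 0 - 2 * (r *m X *m c) 0 0
               + 4 * (r *m X *m X *m c) 0 0))%R %[mod 8])%Z.
Proof.
apply/eqz_modP; exists (- (r *m (X *m X *m X *m \adj N) *m c) 0 0).
rewrite {1}[\adj N]adj_1Dmul2 -/N mulmxBr mulmxBl -!scalemxAr -!scalemxAl.
rewrite !mulmxDr !mulmxDl mulmxN mulNmx mulmx1 -!scalemxAr -!scalemxAl !mulmxA.
move: (r *m c) (r *m X *m c) (r *m X *m X *m c) => p q s.
move: (_ *m \adj N *m c) => t; rewrite !mxE; ring.
Qed.

(** Induction on the size, splitting off the first row [r] and column [c] from
    the remaining block [Y].  Bordering subtracts [4 (r adj(1 + 2Y) c)] from the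
    determinant; as [1 + 2Y] is the identity modulo 2 this is [4 (r c)]
    modulo 8, while [2 (r c)] is what the trace of the square gains. *)
Lemma det_1Dmul2 n (X : 'M[int]_n) :
  (forall i, X i i = 0) ->
  (\det (1%:M + 2 *: X) = 1 - 2 * \tr (X *m X) %[mod 8])%Z.
Proof.
elim: n X => [|n IHn]; last rewrite -[n.+1]/(1 + n)%N; move=> X X0.
  by rewrite det_mx00 /mxtrace big_ord0 mulr0 subr0.
have {IHn} := IHn (drsubmx X).
rewrite -[X]submxK in X0 *; rewrite block_mxKdr.
move: (ulsubmx X) (ursubmx X) (dlsubmx X) (drsubmx X) X0 => x r c Y X0.
have x0 : x = 0.
  apply/matrixP=> i j; rewrite !ord1; have := X0 (lshift n 0).
  by rewrite block_mxEul => ->; rewrite mxE.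
have Y0 i : Y i i = 0 by have := X0 (rshift 1 i); rewrite block_mxEdr.
move=> /(_ Y0)/eqz_modP[k Dk].
have detN0 : \det (1%:M + 2 *: Y) != 0.
  have := odd_neq0 (- \tr (Y *m Y) + 4 * k); congr (_ != 0); rewrite Dk; ring.
have [l Dl] := (eqz_modP _ _ _).1 (form_adj_1Dmul2 Y r c).
rewrite scalar_mx_block scale_block_mx add_block_mx x0 scaler0 addr0.
rewrite !add0r det_bordered // mul1r -!scalemxAl -scalemxAr scalerA mxE Dl.
rewrite mulmx_block mul0mx mulmx0 !add0r mxtrace_block mxtraceD.
rewrite (mxtrace_mulC c) trace_mx11 Dk; apply/eqz_modP.
move: (\tr (Y *m Y)) ((r *m c) 0 0) ((r *m Y *m c) 0 0) => t p q.
move: ((r *m Y *m Y *m c) 0 0) => s.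
exists (k - 4 * l + p * (t - 4 * k) + (1 - 2 * t + 8 * k) * (q - 2 * s)).
ring.
Qed.

(** * Edge counts and degree sums *)

(** Handshake lemma: the fibre over an edge [{x, y}] of the map from ordered
    adjacent pairs to edges consists of [(x, y)] and [(y, x)]. *)
Lemma sum_adj (T : finType) (G : simple_graph T) :
  (\sum_x \sum_y adj G x y = 2 * #|edge_set G|)%N.
Proof.
rewrite pair_bigA /= -big_mkcond /=.
rewrite (partition_big (fun p => [set p.1; p.2]) (mem (edge_set G))) /=; last first.
  by move=> [x y] /= xy; apply/imset2P; exists x y.
rewrite mulnC -sum_nat_const; apply: eq_bigr => E /imset2P[x y _ yx ->].
have {}xy : adj G x y := yx.
have nxy : x != y by apply: contraTneq xy => ->; rewrite adj_irrefl.
rewrite sum1dep_card -[RHS]/(nat_of_bool true).+1.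
have <- : ((x, y) != (y, x)) = true by rewrite xpair_eqE negb_and nxy.
rewrite -cards2; apply: eq_card => [[a b]]; rewrite !inE /= !xpair_eqE.
apply/andP/orP => [[ab /eqP Eab] | [] /andP[/eqP-> /eqP->]]; last 2 first.
- by [].
- by rewrite adj_sym xy setUC.
have nab : a != b by apply: contraTneq ab => ->; rewrite adj_irrefl.
have : a \in [set x; y] by rewrite -Eab set21.
have : b \in [set x; y] by rewrite -Eab set22.
rewrite !inE => /orP[]/eqP Db /orP[]/eqP Da; move: nab; rewrite Da Db !eqxx //.
  by right.
by left.
Qed.

Lemma sum_adjacency (T : finType) (G : simple_graph T) :
  \sum_i \sum_j adjacency_matrix G i j = 2 * #|edge_set G|%:Z.
Proof.
transitivity (\sum_x \sum_y (adj G x y)%:R : int).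
  rewrite [RHS]big_enum_val; apply: eq_bigr => i _.
  by rewrite [RHS]big_enum_val; apply: eq_bigr => j _; rewrite mxE.
rewrite -PoszM -sum_adj -natz natr_sum; apply: eq_bigr => x _.
by rewrite natr_sum.
Qed.

Lemma trace_adjacency_sqr (T : finType) (G : simple_graph T) :
  \tr (adjacency_matrix G *m adjacency_matrix G) = 2 * #|edge_set G|%:Z.
Proof.
rewrite -sum_adjacency; apply: eq_bigr => i _; rewrite mxE.
apply: eq_bigr => j _; rewrite !mxE adj_sym.
by case: (adj G _ _); rewrite ?mulr1 ?mulr0.
Qed.

(** By symmetry of the adjacency matrix the sum is that of the squared degrees;
    a square has the parity of its root, and the degrees have an even sum. *)
Lemma even_sum_adjacency_sqr (T : finType) (G : simple_graph T) :
  (2 %| \sum_i \sum_j (adjacency_matrix G *m adjacency_matrix G) i j)%Z.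
Proof.
set A := adjacency_matrix G; pose d i := \sum_j A i j.
have AT i j : A i j = A j i by rewrite !mxE adj_sym.
have -> : \sum_i \sum_j (A *m A) i j = \sum_i d i ^+ 2.
  transitivity (\sum_i \sum_j \sum_k A k i * A k j).
    by do 2!apply: eq_bigr => ? _; rewrite mxE; apply: eq_bigr => ? _; rewrite AT.
  under eq_bigr => i _ do rewrite exchange_big.
  rewrite exchange_big; apply: eq_bigr => k _; rewrite expr2 mulr_suml.
  by apply: eq_bigr => i _; rewrite mulr_sumr.
have -> : \sum_i d i ^+ 2 = \sum_i (d i ^+ 2 - d i) + 2 * #|edge_set G|%:Z.
  by rewrite -sum_adjacency -big_split; apply: eq_bigr => i _; rewrite /= subrK.
rewrite rpredD ?dvdz_mulr // rpred_sum // => i _.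
have [q [->|->]] : exists q, d i = 2 * q \/ d i = 2 * q + 1; last 2 first.
- by apply/dvdzP; exists (q * (2 * q - 1)); ring.
- by apply/dvdzP; exists (q * (2 * q + 1)); ring.
exists (d i %/ 2)%Z; have := divz_eq (d i) 2; rewrite [_ * 2]mulrC.
have := modz_ge0 (d i) (isT : 2 != 0 :> int).
have := ltz_pmod (d i) (isT : 0 < 2 :> int).
by case: (d i %% 2)%Z => [[|[]]|] // _ _ D; [left | right]; rewrite {1}D ?addr0.
Qed.

Lemma form_ones (R : pzRingType) n (M : 'M[R]_n) :
  ((const_mx 1 : 'rV_n) *m M *m (const_mx 1 : 'cV_n)) 0 0
    = \sum_i \sum_j M i j.
Proof.
rewrite mxE exchange_big; apply: eq_bigr => j _; rewrite !mxE mulr1.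
by apply: eq_bigr => i _; rewrite mxE mul1r.
Qed.

(** * The congruence *)

Theorem theorem3p5 (T : finType) (G : simple_graph T) (n e : nat)
    (hn : n = #|T|) (he : e = #|edge_set G|) (hn2 : (2 <= n)%N) :
  (\det (all_ones_matrix #|T| - 2 *: adjacency_matrix G - 1%:M)
     = (-1) ^+ n * (1 - n%:Z) + 4 * e%:Z * n%:Z %[mod 8])%Z.
Proof.
rewrite {}he {}hn {n hn2}; set A := adjacency_matrix G; set m := #|edge_set G|%:Z.
pose N := 1%:M + 2 *: A.
pose u : 'rV[int]_#|T| := const_mx 1; pose v : 'cV[int]_#|T| := const_mx 1.
have A0 i : A i i = 0 by rewrite mxE adj_irrefl.
have [k detN] := (eqz_modP _ _ _).1 (det_1Dmul2 A0).
have {}detN : \det N = 1 - 4 * m + k * 8.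
  by rewrite detN trace_adjacency_sqr -/m; ring.
have detN0 : \det N != 0.
  by have := odd_neq0 (4 * k - 2 * m); congr (_ != 0); rewrite detN; ring.
have -> : all_ones_matrix #|T| - 2 *: A - 1%:M = - (N - v *m u).
  apply/matrixP=> i j; rewrite !mxE big_ord1 !mxE; ring.
have [l Dl] := (eqz_modP _ _ _).1 (form_adj_1Dmul2 A u v).
have uv : (u *m v) 0 0 = #|T|%:Z.
  rewrite mxE (eq_bigr (fun _ => 1)) => [|i _]; last by rewrite !mxE mulr1.
  by rewrite sumr_const card_ord natz.
have uAv := form_ones A; rewrite sum_adjacency -/m -/u -/v in uAv.
have [s Ds] := dvdzP (even_sum_adjacency_sqr G).
have uA2v := form_ones (A *m A); rewrite Ds -/u -/v mulmxA in uA2v.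
(* The sign is odd, hence disappears modulo 8 in front of [4 * m * #|T|]. *)
have [t Dt] : exists t, (-1) ^+ #|T| = 1 + 2 * t :> int.
  by rewrite -signr_odd; case: (odd #|T|); [exists (-1) | exists 0].
apply/eqz_modP; rewrite -scaleN1r detZ det_sub_rank1 // Dl uv uAv uA2v detN Dt.
exists ((1 + 2 * t) * (k * (1 - #|T|%:Z + 4 * m - 8 * s) - s * (1 - 4 * m)
                       - 2 * m ^+ 2 - l) + t * m * #|T|%:Z).
ring.
Qed.
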